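(* Let $f_i$ ($i\in\mathcal V$) and $g_{\{i,j\}}$ ($\{i,j\}\in\mathcal E$) satisfy the following assumptions (all notation is as in the context). (A1) For each $i\in\mathcal V$, $f_i$ is twice continuously differentiable and locally strongly convex, $f_i$ has a minimizer, and $\nabla^2 f_i$ is locally Lipschitz continuous. (A2) For each $\{i,j\}\in\mathcal E$, $g_{\{i,j\}}$ is twice continuously differentiable and locally strongly convex. (A3) For each $i\in\mathcal V$, $x\mapsto f_i(x^* )-f_i(x)-\nabla f_i(x)^T(x^*-x)$ is coercive. Let $\mathbf x^k=[x_1^k;\ldots;x_N^k]$, $k\ge 0$, be generated by the DEAN iteration with step-sizes $0<\alpha_{\{i,j\}}\le\bar\alpha$ for all $\{i,j\}\in\mathcal E$. Suppose that for every $\{i,j\}\in\mathcal E$, $$\alpha_{\{i,j\}}<\frac{1}{2\Gamma_{\{i,j\}}}\min\Bigl\{\frac{\theta_i^2}{|\mathcal N_i|}\Bigl(\Theta'_i-\frac{\theta'_i}{2}+\frac{L'_i}{2}\sqrt{\frac{2V(\mathbf x^0)}{\theta_i}}\Bigr)^{-1},\ \frac{\theta_j^2}{|\mathcal N_j|}\Bigl(\Theta'_j-\frac{\theta'_j}{2}+\frac{L'_j}{2}\sqrt{\frac{2V(\mathbf x^0)}{\theta_j}}\Bigr)^{-1}\Bigr\}.$$ Then $$\lim_{k\to\infty}\|x_i^k-x_j^k\|=0,\quad\forall i,j\in\mathcal V.$$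
   Context: **Network and problem.** $\mathcal G=(\mathcal V,\mathcal E)$ is an undirected connected graph, $\mathcal V=\{1,\dots,N\}$, $N\ge2$, $\mathcal E\subseteq\{\{i,j\}:i,j\in\mathcal V,\ i\ne j\}$ (unordered pairs), and $\mathcal N_i=\{j\in\mathcal V:\{i,j\}\in\mathcal E\}$. Each node $i$ has a function $f_i:\mathbb R^n\to\mathbb R$, and each link $\{i,j\}\in\mathcal E$ has a function $g_{\{i,j\}}:\mathbb R^n\to\mathbb R$. $\|\cdot\|$ is the Euclidean norm (for matrices, the induced spectral norm); $[z_1;\dots;z_N]\in\mathbb R^{nN}$ denotes stacking; $A\succeq B$ means $A-B$ is positive semidefinite; $\operatorname{conv}$ is the convex hull. A twice continuously differentiable $f:\mathbb R^n\to\mathbb R$ is *locally strongly convex* if for every convex compact set $\mathcal C$ there is $\theta_{\mathcal C}>0$ with $\nabla^2 f(x)\succeq\theta_{\mathcal C}I_n$ for all $x\in\mathcal C$. A vector- or matrix-valued function $h$ is *locally Lipschitz continuous* if for every compact $\mathcal C$ in its domain there is $L_{\mathcal C}\ge0$ with $\|h(x)-h(y)\|\le L_{\mathcal C}\|x-y\|$ for all $x,y\in\mathcal C$. Under assumption (A1), each $f_i$ has a unique minimizer $x_i^*\in\mathbb R^n$, and $\min_{x\in\mathbb R^n}\sum_{i\in\mathcal V}f_i(x)$ has a unique optimal solution $x^*$. **DEAN iteration.** Given symmetric link step-sizes $\alpha_{\{i,j\}}>0$, set $x_i^0=x_i^*$ for all $i\in\mathcal V$ and, for $k\ge0$ and all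 $i\in\mathcal V$, $$x_i^{k+1}=x_i^k+(\nabla^2 f_i(x_i^k))^{-1}\sum_{j\in\mathcal N_i}\alpha_{\{i,j\}}\bigl(\nabla g_{\{i,j\}}(x_j^k)-\nabla g_{\{i,j\}}(x_i^k)\bigr).$$ **Lyapunov function.** For $\mathbf x=[x_1;\dots;x_N]\in\mathbb R^{nN}$, $V(\mathbf x)=\sum_{i\in\mathcal V}\bigl(f_i(x^* )-f_i(x_i)-\nabla f_i(x_i)^T(x^*-x_i)\bigr)$. **Constants.** With $\mathbf x^0=[x_1^*;\dots;x_N^*]$, let $\mathcal C_i=\{x\in\mathbb R^n: f_i(x^* )-f_i(x)-\nabla f_i(x)^T(x^*-x)\le V(\mathbf x^0)\}$, which is compact under (A3). Fix: - $\Theta_i,\theta_i\in(0,\infty)$ with $\Theta_iI_n\succeq\nabla^2 f_i(x)\succeq\theta_iI_n$ for all $x\in\operatorname{conv}\mathcal C_i$; - $L_i\in[0,\infty)$ a Lipschitz constant of $\nabla^2 f_i$ on $\operatorname{conv}\mathcal C_i$; - $\Gamma_{\{i,j\}},\gamma_{\{i,j\}}\in(0,\infty)$ with $\Gamma_{\{i,j\}}I_n\succeq\nabla^2 g_{\{i,j\}}(x)\succeq\gamma_{\{i,j\}}I_n$ for all $x\in\operatorname{conv}(\mathcal C_i\cup\mathcal C_j)$; - an arbitrary $\bar\alpha>0$, and $\delta_i=\frac{\bar\alpha}{\theta_i}\sum_{j\in\mathcal N_i}\Gamma_{\{i,j\}}\Bigl(\sqrt{2V(\mathbf x^0)/\theta_i}+\sqrt{2V(\mathbf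 x^0)/\theta_j}\Bigr)$; - $\mathcal C_i'=\operatorname{conv}\{x\in\mathbb R^n:\|x-y\|\le\delta_i \text{ for some } y\in\mathcal C_i\}$ (compact, containing $\operatorname{conv}\mathcal C_i$); - $\Theta_i',\theta_i'\in(0,\infty)$ with $\Theta_i'I_n\succeq\nabla^2 f_i(x)\succeq\theta_i'I_n$ for all $x\in\mathcal C_i'$, and $L_i'\in[0,\infty)$ a Lipschitz constant of $\nabla^2 f_i$ on $\mathcal C_i'$, where $\Theta_i'\ge\Theta_i$, $\theta_i'\le\theta_i$, $L_i'\ge L_i$. *)

(* Defs.v *)
From HB Require Import structures.
From mathcomp Require Import all_boot all_order all_algebra.
From mathcomp Require Import all_classical all_reals all_analysis.

Set Implicit Arguments.
Unset Strict Implicit.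
Unset Printing Implicit Defensive.

Import Order.TTheory GRing.Theory Num.Theory.
Import numFieldNormedType.Exports.

Local Open Scope classical_set_scope.
Local Open Scope ring_scope.

(* R^n is 'rV[R]_n.  The canonical norm of MathComp-Analysis on 'rV[R]_n is the
   max norm: it induces the usual topology and Frechet differentiability, but
   every quantitative statement below uses the Euclidean norm [enorm]. *)

Section Euclidean.
Context {R : realType} {n : nat}.
Implicit Types (u v x : 'rV[R]_n) (A : 'M[R]_n).

Definition dotv u v : R := (u *m v^T) 0 0.

Definition enorm v : R := Num.sqrt (dotv v v).

(* A acts on row vectors by v |-> v *m A; A and its transpose have the same
   spectral norm. *)
Definition specnorm A : R :=
  sup [set enorm (v *m A) | v in [set v | enorm v <= 1]].

Definition psd A : Prop := A^T = A /\ forall v, 0 <= dotv (v *m A) v.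

Definition conv_hull (S : set 'rV[R]_n) : set 'rV[R]_n :=
  smallest (fun C : set 'rV[R]_n =>
    convex_set (C : set (convex_lmodType 'rV[R]_n))) S.

Definition enlarge (delta : R) (S : set 'rV[R]_n) : set 'rV[R]_n :=
  [set x | exists2 y, S y & enorm (x - y) <= delta].

End Euclidean.

Section Functions.
Context {R : realType} {n : nat}.
Implicit Types (f : 'rV[R]_n -> R) (C : set 'rV[R]_n).

Definition grad f (x : 'rV[R]_n) : 'rV[R]_n :=
  \row_i 'D_(delta_mx 0 i) f x.

Definition hess f (x : 'rV[R]_n) : 'M[R]_n := 'J (grad f) x.

Definition twice_cont_diff f : Prop :=
  [/\ forall x, differentiable f x,
      forall x, differentiable (grad f) x
    & continuous (hess f)].

Definition locally_strongly_convex f : Prop :=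
  forall C, convex_set (C : set (convex_lmodType 'rV[R]_n)) -> compact C ->
    exists2 theta : R, 0 < theta &
      forall x, C x -> psd (hess f x - theta%:M).

Definition hess_lipschitz_on C (L : R) f : Prop :=
  forall x y, C x -> C y ->
    specnorm (hess f x - hess f y) <= L * enorm (x - y).

Definition hess_locally_lipschitz f : Prop :=
  forall C, compact C -> exists2 L : R, 0 <= L & hess_lipschitz_on C L f.

Definition hess_bounded_on C (lo hi : R) f : Prop :=
  forall x, C x -> psd (hi%:M - hess f x) /\ psd (hess f x - lo%:M).

Definition coercive f : Prop :=
  forall M : R, exists r : R, forall x, r <= enorm x -> M <= f x.

Definition is_minimizer f (y : 'rV[R]_n) : Prop := forall z, f y <= f z.

Definition bregman f (y x : 'rV[R]_n) : R :=
  f y - f x - dotv (grad f x) (y - x).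

End Functions.

(* An undirected graph on 'I_N is its set E of links, a link being an
   unordered pair; quantities attached to links are functions on {set 'I_N},
   and are therefore symmetric, of which only the values on E matter. *)
Section Network.
Context {N : nat}.
Implicit Types (E : {set {set 'I_N}}) (i j : 'I_N).

Definition link i j : {set 'I_N} := [set i; j]%SET.

Definition simple_graph E : Prop := forall e, e \in E -> #|e| = 2%N.

Definition connected_graph E : Prop :=
  forall i j, connect (fun i j => link i j \in E) i j.

Definition neighbors E i : {set 'I_N} := [set j | link i j \in E]%SET.

Context {R : realType} {n : nat}.
Implicit Types (f : 'I_N -> 'rV[R]_n -> R) (g : {set 'I_N} -> 'rV[R]_n -> R).

Definition lyapunov f (xstar : 'rV[R]_n) (x : 'I_N -> 'rV[R]_n) : R :=
  \sum_i bregman (f i) xstar (x i).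

(* In row form, H^-1 s reads s *m (H^-1)^T. *)
Definition dean_step E f g (alpha : {set 'I_N} -> R) (x : 'I_N -> 'rV[R]_n)
    (i : 'I_N) : 'rV[R]_n :=
  x i + (\sum_(j in neighbors E i) alpha (link i j) *:
           (grad (g (link i j)) (x j) - grad (g (link i j)) (x i)))
        *m (invmx (hess (f i) (x i)))^T.

Definition delta_radius E (alphabar V0 : R) (theta : 'I_N -> R)
    (Gamma : {set 'I_N} -> R) (i : 'I_N) : R :=
  alphabar / theta i * \sum_(j in neighbors E i) Gamma (link i j) *
    (Num.sqrt (2 * V0 / theta i) + Num.sqrt (2 * V0 / theta j)).

(* The quantity attached to the end point i of a link in the step-size
   condition. *)
Definition step_bound E (V0 : R) (theta Theta' theta' L' : 'I_N -> R)
    (i : 'I_N) : R :=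
  theta i ^+ 2 / #|neighbors E i|%:R *
    (Theta' i - theta' i / 2 + L' i / 2 * Num.sqrt (2 * V0 / theta i))^-1.

End Network.

(* Main.v *)
(* The sum V of the Bregman divergences D_i(x*, x_i) decreases along the
   iteration.  Let s_i be the sum of the flows entering node i, d_i the step
   with H_i d_i = s_i, and g_i the increment of the gradient of f_i.  The
   three-point identity gives
     D_i(x*, x_i + d_i) - D_i(x*, x_i) = D_i(x_i, x_i + d_i) - <g_i, x* - x_i>
       <= - <s_i, x* - x_i> + M_i |d_i|^2,
   with M_i = Theta'_i - theta'_i / 2 + (L'_i / 2) sqrt(2 V0 / theta_i), because
   g_i = s_i up to the second-order error (L'_i / 2) |d_i|^2.  The flows are
   antisymmetric, so the linear terms add up to minus half the sum over i and
   its neighbors j of alpha_ij q_ij, where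
   q_ij = <grad g_ij(x_j) - grad g_ij(x_i), x_j - x_i>.  By cocoercivity,
   |d_i|^2 <= |s_i|^2 / theta_i^2
     <= (|N_i| / theta_i^2) sum_j alpha_ij^2 Gamma_ij q_ij.
   The step-size condition makes the total coefficient of each q_ij negative.
   So V decreases, the iterates stay in the sublevel sets C_i, each q_ij tends
   to 0, and q_ij >= gamma_ij |x_i - x_j|^2; connectedness concludes. *)
Require Import Defs.
From HB Require Import structures.
From mathcomp Require Import all_boot all_order all_algebra.
From mathcomp Require Import all_classical all_reals all_analysis.
From mathcomp Require Import ring lra.

Set Implicit Arguments.
Unset Strict Implicit.
Unset Printing Implicit Defensive.

Import Order.TTheory GRing.Theory Num.Theory.
Import numFieldNormedType.Exports.

Local Open Scope classical_set_scope.
Local Open Scope ring_scope.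

(** * Euclidean inner product, norm and spectral norm on row vectors *)

Section EuclideanTheory.
Context {R : realType} {n : nat}.
Implicit Types (u v w : 'rV[R]_n) (A : 'M[R]_n).

Lemma dotvE u v : dotv u v = \sum_j u 0 j * v 0 j.
Proof. by rewrite /dotv mxE; apply: eq_bigr => j _; rewrite mxE. Qed.

Lemma dotvC u v : dotv u v = dotv v u.
Proof. by rewrite !dotvE; apply: eq_bigr => j _; rewrite mulrC. Qed.

Lemma dotvDl u v w : dotv (u + v) w = dotv u w + dotv v w.
Proof. by rewrite /dotv mulmxDl mxE. Qed.

Lemma dotvNl u w : dotv (- u) w = - dotv u w.
Proof. by rewrite /dotv mulNmx mxE. Qed.

Lemma dotvBl u v w : dotv (u - v) w = dotv u w - dotv v w.
Proof. by rewrite dotvDl dotvNl. Qed.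

Lemma dotvZl (a : R) u w : dotv (a *: u) w = a * dotv u w.
Proof. by rewrite /dotv -scalemxAl mxE. Qed.

Lemma dotvDr u v w : dotv w (u + v) = dotv w u + dotv w v.
Proof. by rewrite dotvC dotvDl !(dotvC _ w). Qed.

Lemma dotvNr u w : dotv w (- u) = - dotv w u.
Proof. by rewrite dotvC dotvNl dotvC. Qed.

Lemma dotvBr u v w : dotv w (u - v) = dotv w u - dotv w v.
Proof. by rewrite dotvDr dotvNr. Qed.

Lemma dotvZr (a : R) u w : dotv w (a *: u) = a * dotv w u.
Proof. by rewrite dotvC dotvZl dotvC. Qed.

Lemma dot0v w : dotv 0 w = 0.
Proof. by rewrite -(scale0r 0) dotvZl mul0r. Qed.

Lemma dotv0 w : dotv w 0 = 0.
Proof. by rewrite dotvC dot0v. Qed.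

Lemma dotv_suml (I : Type) (r : seq I) (P : pred I) (F : I -> 'rV[R]_n) w :
  dotv (\sum_(i <- r | P i) F i) w = \sum_(i <- r | P i) dotv (F i) w.
Proof.
by apply: (big_morph (dotv^~ w)) => [u v|]; rewrite ?dotvDl ?dot0v.
Qed.

Lemma dotvv_ge0 u : 0 <= dotv u u.
Proof. by rewrite dotvE; apply: sumr_ge0 => j _; rewrite -expr2 sqr_ge0. Qed.

Lemma dotvv_eq0 u : dotv u u = 0 -> u = 0.
Proof.
rewrite dotvE => /eqP; rewrite psumr_eq0 => [/allP u0|j _]; last first.
  by rewrite -expr2 sqr_ge0.
apply/rowP => j; have := u0 j (mem_index_enum j).
by rewrite /= -expr2 sqrf_eq0 mxE => /eqP.
Qed.

Lemma dotv_symr A u v : A^T = A -> dotv (u *m A) v = dotv u (v *m A).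
Proof. by move=> As; rewrite /dotv trmx_mul As mulmxA. Qed.

Lemma enorm_ge0 u : 0 <= enorm u.
Proof. exact: sqrtr_ge0. Qed.

Lemma enorm_sqr u : enorm u ^+ 2 = dotv u u.
Proof. by rewrite /enorm sqr_sqrtr // dotvv_ge0. Qed.

Lemma enorm_eq0 u : enorm u = 0 -> u = 0.
Proof. by move=> u0; apply: dotvv_eq0; rewrite -enorm_sqr u0 expr0n. Qed.

Lemma enorm0 : enorm (0 : 'rV[R]_n) = 0.
Proof. by rewrite /enorm dot0v sqrtr0. Qed.

Lemma enormZ (a : R) u : enorm (a *: u) = `|a| * enorm u.
Proof.
by rewrite /enorm dotvZl dotvZr mulrA -expr2 sqrtrM ?sqr_ge0 // sqrtr_sqr.
Qed.

Lemma enormN u : enorm (- u) = enorm u.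
Proof. by rewrite -scaleN1r enormZ normrN1 mul1r. Qed.

Lemma enormBC u v : enorm (u - v) = enorm (v - u).
Proof. by rewrite -opprB enormN. Qed.

(** Cauchy-Schwarz: the squared norm of [enorm v *: u - enorm u *: v] is nonnegative and factors as
    [2 * (enorm u * enorm v)] times the gap. *)
Lemma dotv_le u v : dotv u v <= enorm u * enorm v.
Proof.
have [/eqP/enorm_eq0 ->|u0] := boolP (enorm u == 0).
  by rewrite dot0v enorm0 mul0r.
have [/eqP/enorm_eq0 ->|v0] := boolP (enorm v == 0).
  by rewrite dotv0 enorm0 mulr0.
have up : 0 < enorm u by rewrite lt_def u0 enorm_ge0.
have vp : 0 < enorm v by rewrite lt_def v0 enorm_ge0.
have := dotvv_ge0 (enorm v *: u - enorm u *: v).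
rewrite !(dotvBl, dotvBr, dotvZl, dotvZr) -!enorm_sqr (dotvC v u).
rewrite (_ : _ - _ = 2 * (enorm u * enorm v) * (enorm u * enorm v - dotv u v)).
  by rewrite pmulr_rge0 ?mulr_gt0 // subr_ge0.
by ring.
Qed.

Lemma enormD_le u v : enorm (u + v) <= enorm u + enorm v.
Proof.
rewrite -(@ler_pXn2r _ 2%N) // ?nnegrE ?addr_ge0 ?enorm_ge0 //.
rewrite sqrrD !enorm_sqr dotvDl !dotvDr (dotvC v u).
by have := dotv_le u v; lra.
Qed.

Lemma enorm_sum_le (I : Type) (r : seq I) (P : pred I) (F : I -> 'rV[R]_n) :
  enorm (\sum_(i <- r | P i) F i) <= \sum_(i <- r | P i) enorm (F i).
Proof.
apply: (big_ind2 (fun u (b : R) => enorm u <= b)) => [|u a v b ua vb|//].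
  by rewrite enorm0.
exact/(le_trans (enormD_le u v))/lerD.
Qed.

(** The square of the sum is a double sum of inner products, each at most the mean of two squared
    norms; every index then occurs with total weight [#|S|]. *)
Lemma enorm_sum_sqr_le (I : finType) (S : {set I}) (F : I -> 'rV[R]_n) :
  enorm (\sum_(i in S) F i) ^+ 2 <= #|S|%:R * \sum_(i in S) enorm (F i) ^+ 2.
Proof.
have -> : #|S|%:R * \sum_(i in S) enorm (F i) ^+ 2 =
    \sum_(i in S) \sum_(j in S) (enorm (F i) ^+ 2 + enorm (F j) ^+ 2) / 2.
  under [RHS]eq_bigr do rewrite -mulr_suml big_split sumr_const /=.
  by rewrite -mulr_suml big_split /= sumr_const sumrMnl -mulr_natl; field.
rewrite enorm_sqr dotv_suml; apply: ler_sum => i _.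
rewrite dotvC dotv_suml; apply: ler_sum => j _.
rewrite (le_trans (dotv_le _ _)) // ler_pdivlMr //.
by have := sqr_ge0 (enorm (F i) - enorm (F j)); nra.
Qed.

(** The witness is the Frobenius norm. It bounds the set whose supremum defines [specnorm], so that
    this supremum is an upper bound. *)
Lemma enorm_mulmx_bounded A : exists c, forall v, enorm (v *m A) <= enorm v * c.
Proof.
exists (Num.sqrt (\sum_j dotv (col j A)^T (col j A)^T)) => v.
rewrite /enorm -sqrtrM ?dotvv_ge0 // ler_wsqrtr // mulr_sumr.
rewrite [leLHS]dotvE; apply: ler_sum => j _.
have -> : (v *m A) 0 j = dotv v (col j A)^T.
  by rewrite dotvE mxE; apply: eq_bigr => k _; rewrite !mxE.
rewrite -!enorm_sqr -expr2 -exprMn -[leLHS]ger0_norm ?sqr_ge0 // normrX.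
rewrite ler_pXn2r // ?nnegrE ?mulr_ge0 ?enorm_ge0 //.
by rewrite ler_norml -(enormN v) lerNl -dotvNl dotv_le enormN dotv_le.
Qed.

Lemma enorm_mulmx_le A v : enorm (v *m A) <= specnorm A * enorm v.
Proof.
have [/eqP/enorm_eq0 ->|v0] := boolP (enorm v == 0).
  by rewrite mul0mx enorm0 mulr0.
have vp : 0 < enorm v by rewrite lt_def v0 enorm_ge0.
have [c cP] := enorm_mulmx_bounded A.
have c0 : 0 <= c.
  by rewrite -(pmulr_rge0 _ vp) (le_trans _ (cP v)) // enorm_ge0.
rewrite -ler_pdivrMr // mulrC -[X in X * _]ger0_norm ?invr_ge0 ?enorm_ge0 //.
rewrite -enormZ scalemxAl; apply: ub_le_sup; last first.
  exists ((enorm v)^-1 *: v) => //=.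
  by rewrite enormZ ger0_norm ?invr_ge0 ?enorm_ge0 // mulVf.
exists c => _ [w /= w1 <-]; rewrite (le_trans (cP w)) //.
by rewrite -[leRHS]mul1r ler_wpM2r.
Qed.

End EuclideanTheory.

(** * Convex hulls as sets closed under segments *)

Section ConvexHull.
Context {R : realType} {n : nat}.
Implicit Types (S : set 'rV[R]_n) (u v x y d : 'rV[R]_n).

(** Convexity written with a base point and a direction, the form in which functions are restricted
    to lines below. *)
Definition segment_closed S : Prop :=
  forall x d, S x -> S (x + d) -> forall t : R, 0 <= t <= 1 -> S (x + t *: d).

Lemma conv_hull_segment S : segment_closed (conv_hull S).
Proof.
move=> x d Sx Sxd t t01 M [Mconv SM].
have Mx : M x by apply: Sx; split.
have Mxd : M (x + d) by apply: Sxd; split.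
have := Mconv _ _ (Itv01 (andP t01).1 (andP t01).2) (mem_set Mxd) (mem_set Mx).
move=> /set_mem; congr (M _) => /=.
rewrite /conv /= /unstable.onem scalerDr scalerBl scale1r.
by rewrite addrC addrA subrK.
Qed.

Lemma sub_conv_hull S : S `<=` conv_hull S.
Proof. exact: sub_gen_smallest. Qed.

Lemma sub_conv_hull_enlarge S (delta : R) :
  0 <= delta -> S `<=` conv_hull (enlarge delta S).
Proof.
by move=> d0 x Sx; apply: sub_conv_hull; exists x => //; rewrite subrr enorm0.
Qed.

End ConvexHull.

(** * Derivatives along lines and the mean value theorem *)

Section LineCalculus.
Context {R : realType} {n : nat}.
Implicit Types (f : 'rV[R]_n -> R) (S : set 'rV[R]_n) (u v w x y d : 'rV[R]_n).

Lemma is_derive_line (W : normedModType R) (F : 'rV[R]_n -> W) x d (t : R) :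
  differentiable F (x + t *: d) ->
  is_derive t 1 (fun s : R => F (x + s *: d)) ('d F (x + t *: d) d).
Proof.
move=> dF; have E : (fun h : R => h^-1 *: (((fun s : R => F (x + s *: d)) \o shift t)
      (h *: 1) - F (x + t *: d))) =
    (fun h : R => h^-1 *: ((F \o shift (x + t *: d)) (h *: d) - F (x + t *: d))).
  apply/funext => h /=; congr (_ *: (F _ - _)).
  by rewrite [h *: 1]mulr1 scalerDl addrCA.
have dFd := @diff_derivable _ _ _ F _ d dF.
split; first by rewrite /derivable E.
by rewrite -deriveE // /derive E.
Qed.

(** A continuous linear map is its own differential; continuity holds because the map is a finite
    sum of scaled coordinates. *)
Lemma differentiable_dotv w y :
  differentiable (dotv^~ w) y /\ 'd (dotv^~ w) y = dotv^~ w :> (_ -> _).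
Proof.
have lin : linear (dotv^~ w) by move=> a u v; rewrite dotvDl dotvZl.
pose phi := GRing.isLinear.Build R 'rV[R]_n R _ (dotv^~ w) lin.
pose h : {linear 'rV[R]_n -> R} := HB.pack (dotv^~ w) phi.
have hc : continuous h.
  move=> z; rewrite (_ : h = \sum_j (fun M : 'rV[R]_n => M 0 j * w 0 j) :> (_ -> _)).
    apply: (big_ind (fun F : 'rV[R]_n -> R => {for z, continuous F})).
    - exact: cst_continuous.
    - by move=> F G; exact: continuousD.
    - by move=> j _; apply: continuousM; [exact: coord_continuous|exact: cst_continuous].
  by apply/funext => M; rewrite /= dotvE fct_sumE.
have -> : dotv^~ w = h by [].
by split; [exact: linear_differentiable|exact: diff_lin].
Qed.

Lemma dotv_grad f x d : differentiable f x -> dotv (grad f x) d = 'd f x d.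
Proof.
move=> df; rewrite [in RHS](row_sum_delta d) linear_sum dotvE.
by apply: eq_bigr => j _; rewrite linearZ mxE deriveE //= mulrC.
Qed.

Lemma is_derive_grad_line f x d w (t : R) :
  differentiable (grad f) (x + t *: d) ->
  is_derive t 1 (fun s : R => dotv (grad f (x + s *: d)) w)
    (dotv (d *m hess f (x + t *: d)) w).
Proof.
move=> dg; have [dw Dw] := differentiable_dotv w (grad f (x + t *: d)).
have dgw := differentiable_comp dg dw.
have := is_derive_line dgw.
by rewrite diff_comp //= Dw -deriveE // deriveEjacobian.
Qed.

Lemma is_derive_fun_line f x d (t : R) :
  differentiable f (x + t *: d) ->
  is_derive t 1 (fun s : R => f (x + s *: d)) (dotv (grad f (x + t *: d)) d).
Proof. by move=> df; rewrite dotv_grad //; exact: is_derive_line. Qed.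

Lemma mean_value01 (F dF : R -> R) :
  (forall t : R, is_derive t (1 : R) F (dF t)) ->
  exists2 t, 0 <= t <= 1 & F 1 - F 0 = dF t.
Proof.
move=> dFP; have [] := @MVT_segment R F dF 0 1 ler01 (fun t _ => dFP t).
  by apply: derivable_within_continuous => t _; apply: ex_derive.
by move=> t; rewrite in_itv subr0 mulr1 => ? ->; exists t.
Qed.

End LineCalculus.

(** A second-order Taylor bound without integration: the mean value theorem is applied to
    [F s - s * a - c * s ^+ 2], whose derivative is nonnegative on the unit interval. *)
Lemma taylor2_ge {R : realType} (F dF : R -> R) (a c : R) :
  (forall t, is_derive t (1 : R) F (dF t)) ->
  (forall t, 0 <= t <= 1 -> 2 * c * t <= dF t - a) ->
  c <= F 1 - F 0 - a.
Proof.
move=> DF dF_ge.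
have [|t t01] := @mean_value01 R (fun s => F s - s * a - c * s ^+ 2)
    (fun s => dF s - a - 2 * c * s).
  move=> t; apply: is_derive_eq.
  by rewrite /GRing.scale /=; ring.
rewrite expr1n expr0n /=; have := dF_ge t t01; lra.
Qed.

Lemma psdB_form {R : realType} {n : nat} (A B : 'M[R]_n) :
  psd (A - B) -> forall v, dotv (v *m B) v <= dotv (v *m A) v.
Proof.
by move=> [_ AB] v; rewrite -subr_ge0 -dotvBl -mulmxBr.
Qed.

(** * Gradient and Hessian estimates under two-sided Hessian bounds *)

Section SegmentEstimates.
Context {R : realType} {n : nat}.
Variables (f : 'rV[R]_n -> R) (S : set 'rV[R]_n) (lo hi : R).
Hypotheses (f_diff : forall x, differentiable f x)
  (grad_diff : forall x, differentiable (grad f) x)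
  (S_seg : segment_closed S) (f_bnd : hess_bounded_on S lo hi f).
Implicit Types (u v w x y z d : 'rV[R]_n).

Lemma hess_sym z : S z -> (hess f z)^T = hess f z.
Proof.
move=> /f_bnd [[+ _] _]; rewrite linearB /= tr_scalar_mx => /addrI /oppr_inj.
by [].
Qed.

Lemma hess_form_ge z v : S z -> lo * dotv v v <= dotv (v *m hess f z) v.
Proof. by move=> /f_bnd [_ /psdB_form]; rewrite -dotvZl -mul_mx_scalar. Qed.

Lemma hess_form_le z v : S z -> dotv (v *m hess f z) v <= hi * dotv v v.
Proof. by move=> /f_bnd [/psdB_form + _]; rewrite -dotvZl -mul_mx_scalar. Qed.

(** A vector-valued gradient has no mean value point common to all components, so the increment is
    tested against a fixed [w], on which [z] depends. *)
Lemma grad_mean_value x d w : S x -> S (x + d) ->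
  exists2 z, S z & dotv (grad f (x + d) - grad f x) w = dotv (d *m hess f z) w.
Proof.
move=> Sx Sxd.
have [|t t01] := @mean_value01 R (fun s => dotv (grad f (x + s *: d)) w)
    (fun s => dotv (d *m hess f (x + s *: d)) w).
  by move=> t; exact: is_derive_grad_line.
rewrite scale1r scale0r addr0 -dotvBl => ->.
by exists (x + t *: d) => //; exact: S_seg.
Qed.

Lemma grad_form_ge x d : S x -> S (x + d) ->
  lo * dotv d d <= dotv (grad f (x + d) - grad f x) d.
Proof.
by move=> Sx Sxd; have [z Sz ->] := grad_mean_value d Sx Sxd; exact: hess_form_ge.
Qed.

Lemma grad_form_le x d : S x -> S (x + d) ->
  dotv (grad f (x + d) - grad f x) d <= hi * dotv d d.
Proof.
by move=> Sx Sxd; have [z Sz ->] := grad_mean_value d Sx Sxd; exact: hess_form_le.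
Qed.

Lemma bregman_ge x d : S x -> S (x + d) ->
  lo / 2 * dotv d d <= bregman f (x + d) x.
Proof.
move=> Sx Sxd.
have := @taylor2_ge R (fun s => f (x + s *: d))
  (fun s => dotv (grad f (x + s *: d)) d) (dotv (grad f x) d) (lo / 2 * dotv d d).
rewrite scale1r scale0r addr0 /bregman [x + d - x]addrC addKr; apply=> t.
  exact: is_derive_fun_line.
move=> t01; have Sxt := S_seg Sx Sxd t01; case/andP: t01 => t0 t1.
have [->|tn0] := eqVneq t 0; first by rewrite scale0r addr0 subrr mulr0.
have tp : 0 < t by rewrite lt_def tn0.
(* Strong monotonicity between [x] and [x + t *: d] carries a factor [t] on both sides, which
   cancels since [t] is positive. *)
have := grad_form_ge Sx Sxt; rewrite -dotvBl !dotvZr dotvZl => h.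
rewrite -(ler_pM2l tp) (le_trans _ h) // le_eqVlt; apply/orP/or_introl/eqP.
by field.
Qed.

(* Expand [0 <= <u H, u>] at [u = hi d - w], where [w] is the difference of the
   gradients and [H] the Hessian at the mean-value point for [2 w - hi d]. *)
Lemma grad_cocoercive x d : 0 <= lo -> 0 < hi -> S x -> S (x + d) ->
  dotv (grad f (x + d) - grad f x) (grad f (x + d) - grad f x) <=
  hi * dotv (grad f (x + d) - grad f x) d.
Proof.
move=> lo0 hi0 Sx Sxd; set w := grad f (x + d) - grad f x.
have [z Sz] := grad_mean_value (2 *: w - hi *: d) Sx Sxd.
rewrite -/w dotvBr !dotvZr (dotvBr _ _ (d *m _)) !dotvZr => E.
have wH := hess_form_le w Sz; clearbody w.
have := le_trans (mulr_ge0 lo0 (dotvv_ge0 (hi *: d - w))) (hess_form_ge _ Sz).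
rewrite mulmxBl -!scalemxAl !(dotvBl, dotvBr, dotvZl, dotvZr).
rewrite (dotv_symr w d (hess_sym Sz)) (dotvC w (d *m _)).
set a := dotv (d *m _) d in E *; set b := dotv (d *m _) w in E *.
move=> h; rewrite -(ler_pM2l hi0).
by have := congr1 ( *%R hi) E; lra.
Qed.

(** Cocoercivity and Cauchy-Schwarz bound the squared norm of the increment by [hi] times its norm
    times [enorm d]; one factor cancels. *)
Lemma grad_lipschitz x d : 0 <= lo -> 0 < hi -> S x -> S (x + d) ->
  enorm (grad f (x + d) - grad f x) <= hi * enorm d.
Proof.
move=> lo0 hi0 Sx Sxd; have := grad_cocoercive lo0 hi0 Sx Sxd.
set w := _ - _; have [->|w0] := eqVneq (enorm w) 0.
  by rewrite mulr_ge0 ?enorm_ge0 // ltW.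
have wp : 0 < enorm w by rewrite lt_def w0 enorm_ge0.
rewrite -enorm_sqr => h; rewrite -(ler_pM2l wp) -expr2 (le_trans h) //.
by rewrite mulrCA ler_pM2l // dotv_le.
Qed.

Lemma grad_linearization_error L x d w : hess_lipschitz_on S L f ->
  S x -> S (x + d) ->
  dotv (grad f (x + d) - grad f x - d *m hess f x) w <=
  L / 2 * dotv d d * enorm w.
Proof.
move=> fL Sx Sxd; rewrite -(enormN w) -lerN2 -dotvNr.
move: (- w) => {}w; rewrite !dotvBl.
have := @taylor2_ge R (fun s => dotv (grad f (x + s *: d)) w)
  (fun s => dotv (d *m hess f (x + s *: d)) w) (dotv (d *m hess f x) w)
  (- (L / 2 * dotv d d * enorm w)).
rewrite scale1r scale0r addr0; apply=> t.
  exact: is_derive_grad_line.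
move=> t01; have Sxt := S_seg Sx Sxd t01; case/andP: t01 => t0 t1.
rewrite (_ : 2 * _ * t = - (L * (t * enorm d) * enorm d * enorm w)); last first.
  by rewrite -enorm_sqr; field.
rewrite -dotvBl -mulmxBr lerNl -dotvNl (le_trans (dotv_le _ _)) // enormN.
rewrite ler_wpM2r ?enorm_ge0 // (le_trans (enorm_mulmx_le _ _)) //.
rewrite ler_wpM2r ?enorm_ge0 // (le_trans (fL _ _ Sxt Sx)) //.
by rewrite [x + _]addrC addrK enormZ ger0_norm.
Qed.

(** Positive definiteness makes the kernel trivial: a row [v] of the kernel matrix satisfies
    [lo * dotv v v <= 0]. *)
Lemma hess_unit z : 0 < lo -> S z -> hess f z \in unitmx.
Proof.
move=> lo0 Sz; rewrite -row_free_unit -kermx_eq0.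
apply/eqP/row_matrixP => i; rewrite row0; apply: dotvv_eq0.
have := hess_form_ge (row i (kermx (hess f z))) Sz.
have -> : row i (kermx (hess f z)) *m hess f z = 0.
  by rewrite -row_mul mulmx_ker row0.
rewrite dot0v => h; apply/le_anti; rewrite dotvv_ge0 andbT.
by rewrite -(pmulr_rle0 _ lo0).
Qed.

Lemma newton_dir z (s : 'rV[R]_n) : 0 < lo -> S z -> s *m (invmx (hess f z))^T *m hess f z = s.
Proof.
move=> lo0 Sz; rewrite -{2}(hess_sym Sz) -mulmxA -trmx_mul mulmxV ?hess_unit //.
by rewrite trmx1 mulmx1.
Qed.

Lemma hess_enorm_ge z d : S z -> lo * enorm d <= enorm (d *m hess f z).
Proof.
move=> Sz; have [->|d0] := eqVneq (enorm d) 0; first by rewrite mulr0 enorm_ge0.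
have dp : 0 < enorm d by rewrite lt_def d0 enorm_ge0.
rewrite -(ler_pM2r dp) -mulrA -expr2 enorm_sqr.
exact: le_trans (hess_form_ge _ Sz) (dotv_le _ _).
Qed.

End SegmentEstimates.

(** * Bregman divergences and their change in one step *)

Section BregmanStep.
Context {R : realType} {n : nat}.
Implicit Types (f : 'rV[R]_n -> R) (S : set 'rV[R]_n) (x y d : 'rV[R]_n).

Lemma bregman_self f x : bregman f x x = 0.
Proof. by rewrite /bregman !subrr dotv0 subr0. Qed.

(** The derivative at the minimizer in the direction [y - x] vanishes, so the divergence is
    [f y - f x]. This starts the invariant, the iteration being initialized at minimizers. *)
Lemma bregman_at_minimizer_ge0 f x y :
  (forall z, differentiable f z) -> is_minimizer f x -> 0 <= bregman f y x.
Proof.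
move=> df fmin; have D0 := is_derive_fun_line (df (x + 0 *: (y - x))).
have D0' : is_derive (0 : R) (1 : R) (fun s : R => f (x + s *: (y - x))) 0.
  apply: (@derive1_at_min R _ (-1) 1).
  - by lra.
  - move=> t _; exact: (@ex_derive _ _ _ _ _ _ _ (is_derive_fun_line (df _))).
  - by rewrite in_itv /= ltrN10 ltr01.
  - by move=> t _; rewrite scale0r addr0.
have := @derive_val _ _ _ _ _ _ _ D0'.
rewrite (@derive_val _ _ _ _ _ _ _ D0) scale0r addr0 /bregman => ->.
by rewrite subr0 subr_ge0.
Qed.

Lemma enorm_le_bregman f S lo hi (V : R) x y :
  (forall z, differentiable f z) -> (forall z, differentiable (grad f) z) ->
  segment_closed S -> hess_bounded_on S lo hi f -> 0 < lo ->
  S x -> S y -> bregman f y x <= V -> enorm (y - x) <= Num.sqrt (2 * V / lo).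
Proof.
move=> df dg S_seg fb lo0 Sx Sy brV.
have yE : x + (y - x) = y by rewrite addrC subrK.
have := bregman_ge df dg S_seg fb Sx; move=> /(_ (y - x)); rewrite yE.
move=> /(_ Sy)/le_trans/(_ brV) h; rewrite ler_wsqrtr // ler_pdivlMr //; lra.
Qed.

(* Three-point identity: D(y, x+d) - D(y, x) = D(x, x+d) - <g, y - x>, where
   [g] is the increment of the gradient, which is [d H] up to second order. *)
Lemma bregman_step_le f S lo hi L r x y d :
  (forall z, differentiable f z) -> (forall z, differentiable (grad f) z) ->
  segment_closed S -> hess_bounded_on S lo hi f ->
  0 <= L -> hess_lipschitz_on S L f ->
  S x -> S (x + d) -> enorm (y - x) <= r ->
  bregman f y (x + d) - bregman f y x <=
  (hi - lo / 2 + L / 2 * r) * dotv d d - dotv (d *m hess f x) (y - x).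
Proof.
move=> df dg S_seg fb L0 fL Sx Sxd yxr.
have b_ge := bregman_ge df dg S_seg fb Sx Sxd.
have g_le := grad_form_le dg S_seg fb Sx Sxd.
have := grad_linearization_error dg S_seg (- (y - x)) fL Sx Sxd.
rewrite dotvNr enormN dotvBl.
have Ldd : 0 <= L / 2 * dotv d d by rewrite mulr_ge0 ?divr_ge0 ?dotvv_ge0.
have := ler_wpM2l Ldd yxr.
have -> : bregman f y (x + d) - bregman f y x =
    dotv (grad f (x + d) - grad f x) d - bregman f (x + d) x
    - dotv (grad f (x + d) - grad f x) (y - x).
  have -> : d = (x + d) - x by rewrite addrC addKr.
  rewrite [x + (x + d - x)]addrC subrK; move: (x + d) => z.
  by rewrite /bregman !(dotvBl, dotvBr); ring.
move: (dotv (_ - _) (y - x)) (dotv (_ *m _) _) b_ge g_le => A B.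
move: (bregman _ _ _) (dotv (_ - _) d) (enorm _) (dotv d d) => D F e dd.
move=> h1 h2 h3 h4; lra.
Qed.

End BregmanStep.

(** * Sums over links and consensus along paths *)

Section NetworkSums.
Context {R : realType} {N n : nat} (E : {set {set 'I_N}}).

Lemma linkC (i j : 'I_N) : link i j = link j i.
Proof. by rewrite /link finset.setUC. Qed.

Lemma sum_neighborsC (F : 'I_N -> 'I_N -> R) :
  \sum_i \sum_(j in neighbors E i) F i j =
  \sum_i \sum_(j in neighbors E i) F j i.
Proof.
rewrite (exchange_big_dep predT) //=; apply: eq_bigr => i _.
by apply: eq_bigl => j; rewrite !inE linkC.
Qed.

(** The sum is averaged with its copy in which [i] and [j] are exchanged; antisymmetry turns the
    pair [y - x i], [y - x j] into a difference in which [y] cancels. *)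
Lemma sum_antisymmetric_flow (p : 'I_N -> 'I_N -> 'rV[R]_n)
    (x : 'I_N -> 'rV[R]_n) (y : 'rV[R]_n) :
  (forall i j, p j i = - p i j) ->
  \sum_i dotv (\sum_(j in neighbors E i) p i j) (y - x i) =
  \sum_i \sum_(j in neighbors E i) dotv (p i j) (x j - x i) / 2.
Proof.
move=> pN; under eq_bigr do rewrite dotv_suml.
set S := LHS; have SC := sum_neighborsC (fun i j => dotv (p i j) (y - x i)).
have -> : S = (S + S) / 2 by field.
rewrite {2}/S SC -big_split mulr_suml; apply: eq_bigr => i _.
rewrite -big_split mulr_suml; apply: eq_bigr => j _ /=.
by congr (_ / _); rewrite (pN i j) dotvNl -dotvBr opprB addrC addrA subrK.
Qed.

(** Induction on a path from [i] to [j], with the triangle inequality at each link. *)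
Lemma consensus_of_links (x : nat -> 'I_N -> 'rV[R]_n) :
  connected_graph E ->
  (forall i j, link i j \in E -> enorm (x k i - x k j) @[k --> \oo] --> (0 : R)) ->
  forall i j, enorm (x k i - x k j) @[k --> \oo] --> (0 : R).
Proof.
move=> hconn hlink i j; have /connectP[p] := hconn i j.
elim: p i => [|l p IH] i /= => [_ ->|/andP[il lp] jE].
  by under eq_fun do rewrite subrr enorm0; exact: cvg_cst.
apply: (@squeeze_cvgr _ _ _ _ (cst 0)
  (fun k => enorm (x k i - x k l) + enorm (x k l - x k j))).
- near=> k; rewrite enorm_ge0 /=.
  have -> : x k i - x k j = (x k i - x k l) + (x k l - x k j) by rewrite addrA subrK.
  exact: enormD_le.
- exact: cvg_cst.
- by rewrite -(addr0 0); apply: cvgD; [exact: hlink|exact: IH].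
Unshelve. all: by end_near. Qed.

End NetworkSums.

(** * Vanishing decrements and the scalar step-size condition *)

Lemma cvg_sub_succ0 {R : realType} (V : nat -> R) :
  (forall k, 0 <= V k) -> (forall k, V k.+1 <= V k) ->
  V k - V k.+1 @[k --> \oo] --> (0 : R).
Proof.
move=> V0 Vdec.
have /cvg_ex[l Vl] : cvgn V.
  apply: nonincreasing_is_cvgn; first exact/nonincreasing_seqP.
  by exists 0 => _ [k _ <-].
rewrite -(subrr l); apply: cvgB => //.
by move: Vl; rewrite -cvg_shiftS.
Qed.

(** The bound on [a] exceeds a positive number, hence is positive. Since [0^-1 = 0], this excludes
    [m = 0] and forces [0 < M]. *)
Lemma step_size_margin {R : realType} (th M G a : R) (m : nat) :
  0 < th -> 0 < G -> 0 < a -> a < 1 / (2 * G) * (th ^+ 2 / m%:R * M^-1) ->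
  0 < M /\ 0 < a / 2 - M * (m%:R * a ^+ 2 * G / th ^+ 2).
Proof.
move=> th0 G0 a0 aM.
have G20 : 0 < 1 / (2 * G) by rewrite divr_gt0 // mulr_gt0.
have := lt_trans a0 aM; rewrite (pmulr_rgt0 _ G20) => tmM.
have m0 : 0 < m%:R :> R.
  by rewrite lt_def ler0n andbT; apply: contraTneq tmM => ->; rewrite invr0 mulr0 mul0r ltxx.
have tm0 : 0 < th ^+ 2 / m%:R by rewrite divr_gt0 // exprn_gt0.
have M0 : 0 < M by rewrite -invr_gt0 -(pmulr_rgt0 _ tm0).
split=> //.
(* The margin is a positive factor times the slack in the step-size condition. *)
have -> : a / 2 - M * (m%:R * a ^+ 2 * G / th ^+ 2) =
    M * m%:R * a * G / th ^+ 2 * (1 / (2 * G) * (th ^+ 2 / m%:R * M^-1) - a).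
  by field; rewrite !lt0r_neq0.
by rewrite mulr_gt0 ?subr_gt0 // divr_gt0 ?exprn_gt0 // !mulr_gt0.
Qed.

(** * Descent of the Lyapunov function in one DEAN step *)

Section Descent.
Context {R : realType} {N n : nat} (E : {set {set 'I_N}}).
Variables (f : 'I_N -> 'rV[R]_n -> R) (g : {set 'I_N} -> 'rV[R]_n -> R).
Hypotheses (f_diff : forall i z, differentiable (f i) z)
  (gradf_diff : forall i z, differentiable (grad (f i)) z)
  (gradg_diff : forall e, e \in E -> forall z, differentiable (grad (g e)) z).
Variables (y : 'rV[R]_n) (V0 : R).
Let C i := [set z | bregman (f i) y z <= V0].
Variables (Theta theta Theta' theta' L' : 'I_N -> R) (Gamma gamma : {set 'I_N} -> R).
Hypotheses (V0_ge0 : 0 <= V0) (theta_gt0 : forall i, 0 < theta i)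
  (theta'_gt0 : forall i, 0 < theta' i) (L'_ge0 : forall i, 0 <= L' i)
  (Gamma_gt0 : forall e, e \in E -> 0 < Gamma e)
  (gamma_gt0 : forall e, e \in E -> 0 < gamma e)
  (f_bnd : forall i, hess_bounded_on (conv_hull (C i)) (theta i) (Theta i) (f i))
  (g_bnd : forall i j, link i j \in E ->
     hess_bounded_on (conv_hull (C i `|` C j))
       (gamma (link i j)) (Gamma (link i j)) (g (link i j))).
Variables (alphabar : R) (alpha : {set 'I_N} -> R).
Let C' i := conv_hull (enlarge (delta_radius E alphabar V0 theta Gamma i) (C i)).
Hypotheses
  (f_bnd' : forall i, hess_bounded_on (C' i) (theta' i) (Theta' i) (f i))
  (f_L' : forall i, hess_lipschitz_on (C' i) (L' i) (f i))
  (alpha_gt0 : forall e, e \in E -> 0 < alpha e)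
  (alpha_le : forall e, e \in E -> alpha e <= alphabar)
  (alpha_lt : forall i j, link i j \in E ->
     alpha (link i j) < 1 / (2 * Gamma (link i j)) *
       step_bound E V0 theta Theta' theta' L' i).

Let radius i := Num.sqrt (2 * V0 / theta i).
Let M i := Theta' i - theta' i / 2 + L' i / 2 * radius i.

(** Net coefficient of [link_energy x i j] in the decrease: half the step-size, because the linear
    terms are symmetrized over both ends of a link, minus the second-order cost at node [i]. *)
Definition link_margin i j : R := alpha (link i j) / 2 -
  M i * (#|neighbors E i|%:R * alpha (link i j) ^+ 2 * Gamma (link i j) / theta i ^+ 2).

Definition link_energy (x : 'I_N -> 'rV[R]_n) i j : R :=
  dotv (grad (g (link i j)) (x j) - grad (g (link i j)) (x i)) (x j - x i).

Lemma link_margin_gt0 i j : link i j \in E -> 0 < link_margin i j.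
Proof.
move=> ij; have := alpha_lt ij; rewrite /step_bound => /step_size_margin.
by move=> /(_ (theta_gt0 i) (Gamma_gt0 ij) (alpha_gt0 ij)) [].
Qed.

Lemma curvature_gt0 i j : link i j \in E -> 0 < M i.
Proof.
move=> ij; have := alpha_lt ij; rewrite /step_bound => /step_size_margin.
by move=> /(_ (theta_gt0 i) (Gamma_gt0 ij) (alpha_gt0 ij)) [].
Qed.

Let Cy i : C i y.
Proof. by rewrite /C /= bregman_self. Qed.

Variable x : 'I_N -> 'rV[R]_n.
Hypothesis xC : forall i, C i (x i).

Let flow i j := alpha (link i j) *:
  (grad (g (link i j)) (x j) - grad (g (link i j)) (x i)).
Let s i := \sum_(j in neighbors E i) flow i j.
Let d i := s i *m (invmx (hess (f i) (x i)))^T.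

(** Strong monotonicity of the gradient of the link function; the hull of the union of both sublevel
    sets contains the segment from [x i] to [x j]. *)
Lemma link_energy_ge i j : link i j \in E ->
  gamma (link i j) * enorm (x i - x j) ^+ 2 <= link_energy x i j.
Proof.
move=> ij; rewrite enormBC enorm_sqr.
have := grad_form_ge (gradg_diff ij) (@conv_hull_segment _ _ _) (g_bnd ij).
move=> /(_ (x i) (x j - x i)); rewrite [x i + _]addrC subrK; apply.
- by apply: sub_conv_hull; left.
- by apply: sub_conv_hull; right.
Qed.

Lemma link_energy_cocoercive i j : link i j \in E ->
  enorm (grad (g (link i j)) (x j) - grad (g (link i j)) (x i)) ^+ 2 <=
  Gamma (link i j) * link_energy x i j.
Proof.
move=> ij; rewrite enorm_sqr.
have := grad_cocoercive (gradg_diff ij) (@conv_hull_segment _ _ _) (g_bnd ij).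
move=> /(_ (x i) (x j - x i) (ltW (gamma_gt0 ij)) (Gamma_gt0 ij)).
rewrite [x i + _]addrC subrK; apply.
- by apply: sub_conv_hull; left.
- by apply: sub_conv_hull; right.
Qed.

Lemma link_grad_lipschitz i j : link i j \in E ->
  enorm (grad (g (link i j)) (x j) - grad (g (link i j)) (x i)) <=
  Gamma (link i j) * enorm (x j - x i).
Proof.
move=> ij.
have := grad_lipschitz (gradg_diff ij) (@conv_hull_segment _ _ _) (g_bnd ij).
move=> /(_ (x i) (x j - x i) (ltW (gamma_gt0 ij)) (Gamma_gt0 ij)).
rewrite [x i + _]addrC subrK; apply.
- by apply: sub_conv_hull; left.
- by apply: sub_conv_hull; right.
Qed.

Lemma dist_opt_le i : enorm (y - x i) <= radius i.
Proof.
exact: (enorm_le_bregman (f_diff i) (@gradf_diff i) (@conv_hull_segment _ _ _)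
  (@f_bnd i) (theta_gt0 i) (sub_conv_hull (xC i)) (sub_conv_hull (Cy i)) (xC i)).
Qed.

Lemma dean_step_newton i : d i *m hess (f i) (x i) = s i.
Proof.
by apply: (newton_dir (@f_bnd i)) => //; exact: sub_conv_hull.
Qed.

Lemma dean_step_enorm_le i : theta i * enorm (d i) <= enorm (s i).
Proof.
rewrite -dean_step_newton; apply: (hess_enorm_ge (@f_bnd i)).
exact: sub_conv_hull.
Qed.

(** Keeps the new point in [C' i], where the primed constants hold, before any descent is known.
    Each flow is bounded through [y], at distance at most [radius i] from [x i] and [radius j] from
    [x j]. *)
Lemma dean_step_radius i : enorm (d i) <= delta_radius E alphabar V0 theta Gamma i.
Proof.
rewrite -(ler_pM2l (theta_gt0 i)) (le_trans (dean_step_enorm_le i)) //.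
rewrite /delta_radius mulrA (mulrCA (theta i)) divff ?lt0r_neq0 // mulr1.
rewrite mulr_sumr (le_trans (enorm_sum_le _ _ _)) //; apply: ler_sum => j.
rewrite inE => ij; rewrite enormZ gtr0_norm ?alpha_gt0 //.
apply: ler_pM; rewrite ?enorm_ge0 ?(ltW (alpha_gt0 ij)) ?alpha_le //.
rewrite (le_trans (link_grad_lipschitz ij)) // ler_pM2l ?Gamma_gt0 //.
have -> : x j - x i = (y - x i) - (y - x j) by rewrite opprB [RHS]addrC addrA subrK.
by rewrite (le_trans (enormD_le _ _)) // enormN lerD // dist_opt_le.
Qed.

Lemma dean_step_sqr_le i : dotv (d i) (d i) <=
  \sum_(j in neighbors E i) #|neighbors E i|%:R * alpha (link i j) ^+ 2 *
    Gamma (link i j) / theta i ^+ 2 * link_energy x i j.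
Proof.
have th2 : 0 < theta i ^+ 2 by rewrite exprn_gt0.
have sd : theta i ^+ 2 * dotv (d i) (d i) <= enorm (s i) ^+ 2.
  have th0 := ltW (theta_gt0 i); have sd := dean_step_enorm_le i.
  by rewrite -enorm_sqr -exprMn ler_pXn2r // ?nnegrE ?mulr_ge0 ?enorm_ge0.
rewrite -(ler_pM2l th2) (le_trans sd) // (le_trans (enorm_sum_sqr_le _ _)) //.
rewrite !mulr_sumr; apply: ler_sum => j; rewrite inE => ij.
rewrite enormZ exprMn gtr0_norm ?alpha_gt0 //.
have -> : theta i ^+ 2 * (#|neighbors E i|%:R * alpha (link i j) ^+ 2 *
    Gamma (link i j) / theta i ^+ 2 * link_energy x i j) =
  #|neighbors E i|%:R * (alpha (link i j) ^+ 2 *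
    (Gamma (link i j) * link_energy x i j)).
  by field; rewrite lt0r_neq0.
by rewrite ler_wpM2l // ler_wpM2l ?sqr_ge0 // link_energy_cocoercive.
Qed.

Lemma delta_radius_ge0 i : 0 <= delta_radius E alphabar V0 theta Gamma i.
Proof. exact: le_trans (enorm_ge0 _) (dean_step_radius i). Qed.

Lemma dean_step_enlarged i : C' i (x i + d i).
Proof.
apply: sub_conv_hull; exists (x i) => //.
by rewrite [x i + _]addrC addrK; exact: dean_step_radius.
Qed.

(** Nonnegativity of every single divergence is what turns a bound on their sum into membership in
    each sublevel set. It follows from the Hessian lower bound on [C' i], which contains both the
    new point and [y]. *)
Lemma bregman_dean_step_ge0 i : 0 <= bregman (f i) y (dean_step E f g alpha x i).
Proof.
rewrite (_ : dean_step _ _ _ _ _ _ = x i + d i) //.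
have Cz : C' i (x i + d i) by exact: dean_step_enlarged.
have Cy' : C' i y by apply: sub_conv_hull_enlarge => //; exact: delta_radius_ge0.
move: (x i + d i) Cz => z Cz; have zE : z + (y - z) = y by rewrite addrC subrK.
have := @bregman_ge _ _ _ _ _ _ (f_diff i) (@gradf_diff i) (@conv_hull_segment _ _ _)
  (@f_bnd' i) z (y - z) Cz; rewrite zE => /(_ Cy').
by apply: le_trans; rewrite mulr_ge0 ?dotvv_ge0 // divr_ge0 // ltW.
Qed.

Lemma dean_step_curvature_le i : M i * dotv (d i) (d i) <=
  \sum_(j in neighbors E i) (M i * (#|neighbors E i|%:R * alpha (link i j) ^+ 2 *
    Gamma (link i j) / theta i ^+ 2) * link_energy x i j).
Proof.
under eq_bigr do rewrite -mulrA.
rewrite -mulr_sumr.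
(* The sign of [M i] comes from the step-size condition on a link at [i]; at a node without
   neighbors the step is zero. *)
have [Ni0|[j]] := set_0Vmem (neighbors E i).
  by rewrite /d /s Ni0 !big_set0 mul0mx dot0v.
by rewrite inE => /curvature_gt0 Mi0; rewrite ler_pM2l // dean_step_sqr_le.
Qed.

Lemma lyapunov_dean_step_le :
  lyapunov f y (dean_step E f g alpha x) +
    \sum_i \sum_(j in neighbors E i) link_margin i j * link_energy x i j <=
  lyapunov f y x.
Proof.
rewrite -lerBrDl -lerN2 opprB.
have flowN i j : flow j i = - flow i j by rewrite /flow linkC -scalerN opprB.
have -> : lyapunov f y (dean_step E f g alpha x) - lyapunov f y x =
    \sum_i (bregman (f i) y (x i + d i) - bregman (f i) y (x i)).
  by rewrite sumrB.
have step i : bregman (f i) y (x i + d i) - bregman (f i) y (x i) <=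
    \sum_(j in neighbors E i) (M i * (#|neighbors E i|%:R * alpha (link i j) ^+ 2 *
    Gamma (link i j) / theta i ^+ 2) * link_energy x i j) - dotv (s i) (y - x i).
  rewrite (le_trans (bregman_step_le (f_diff i) (@gradf_diff i)
    (@conv_hull_segment _ _ _) (@f_bnd' i) (L'_ge0 i) (@f_L' i)
    (sub_conv_hull_enlarge (delta_radius_ge0 i) (xC i))
    (@dean_step_enlarged i) (dist_opt_le i))) //.
  by rewrite dean_step_newton lerD2r dean_step_curvature_le.
apply: le_trans (ler_sum _ (fun i _ => step i)) _.
(* The linear terms become half the step-sizes times the link energies; what remains is a termwise
   identity. *)
rewrite sumrB (sum_antisymmetric_flow _ _ _ flowN) -sumrB -sumrN.
rewrite le_eqVlt; apply/orP/or_introl/eqP; apply: eq_bigr => i _.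
rewrite -sumrB -sumrN; apply: eq_bigr => j _.
rewrite /flow dotvZl -/(link_energy x i j) /link_margin.
by field; rewrite lt0r_neq0.
Qed.

End Descent.

(** * Invariance of the sublevel sets and convergence to consensus *)

Theorem theorem1 (R : realType) (N n : nat) (hN : (2 <= N)%N)
  (E : {set {set 'I_N}}) (hE : simple_graph E) (hconn : connected_graph E)
  (f : 'I_N -> 'rV[R]_n -> R) (g : {set 'I_N} -> 'rV[R]_n -> R)
  (* (A1); xmin i is the minimizer of f i *)
  (xmin : 'I_N -> 'rV[R]_n)
  (f_C2 : forall i, twice_cont_diff (f i))
  (f_sc : forall i, locally_strongly_convex (f i))
  (f_min : forall i, is_minimizer (f i) (xmin i))
  (f_lip : forall i, hess_locally_lipschitz (f i))
  (* (A2) *)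
  (g_C2 : forall e, e \in E -> twice_cont_diff (g e))
  (g_sc : forall e, e \in E -> locally_strongly_convex (g e))
  (* the optimal solution and (A3) *)
  (xstar : 'rV[R]_n)
  (xstar_min : is_minimizer (fun x => \sum_i f i x) xstar)
  (f_coercive : forall i, coercive (bregman (f i) xstar))
  (* constants *)
  (V0 := lyapunov f xstar xmin)
  (C := fun i : 'I_N => [set x | bregman (f i) xstar x <= V0])
  (Theta theta L : 'I_N -> R)
  (Theta_gt0 : forall i, 0 < Theta i) (theta_gt0 : forall i, 0 < theta i)
  (L_ge0 : forall i, 0 <= L i)
  (f_bnd : forall i, hess_bounded_on (conv_hull (C i)) (theta i) (Theta i) (f i))
  (f_L : forall i, hess_lipschitz_on (conv_hull (C i)) (L i) (f i))
  (Gamma gamma : {set 'I_N} -> R)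
  (Gamma_gt0 : forall e, e \in E -> 0 < Gamma e)
  (gamma_gt0 : forall e, e \in E -> 0 < gamma e)
  (g_bnd : forall i j, link i j \in E ->
     hess_bounded_on (conv_hull (C i `|` C j))
       (gamma (link i j)) (Gamma (link i j)) (g (link i j)))
  (alphabar : R) (alphabar_gt0 : 0 < alphabar)
  (delta := delta_radius E alphabar V0 theta Gamma)
  (C' := fun i : 'I_N => conv_hull (enlarge (delta i) (C i)))
  (Theta' theta' L' : 'I_N -> R)
  (Theta'_gt0 : forall i, 0 < Theta' i) (theta'_gt0 : forall i, 0 < theta' i)
  (L'_ge0 : forall i, 0 <= L' i)
  (f_bnd' : forall i, hess_bounded_on (C' i) (theta' i) (Theta' i) (f i))
  (f_L' : forall i, hess_lipschitz_on (C' i) (L' i) (f i))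
  (Theta_le : forall i, Theta i <= Theta' i)
  (theta_le : forall i, theta' i <= theta i)
  (L_le : forall i, L i <= L' i)
  (* step-sizes *)
  (alpha : {set 'I_N} -> R)
  (alpha_gt0 : forall e, e \in E -> 0 < alpha e)
  (alpha_le : forall e, e \in E -> alpha e <= alphabar)
  (alpha_lt : forall i j, link i j \in E ->
     alpha (link i j) < 1 / (2 * Gamma (link i j)) *
       Num.min (step_bound E V0 theta Theta' theta' L' i)
               (step_bound E V0 theta Theta' theta' L' j))
  (* the DEAN iteration *)
  (x : nat -> 'I_N -> 'rV[R]_n)
  (x_init : forall i, x 0%N i = xmin i)
  (x_step : forall k i, x k.+1 i = dean_step E f g alpha (x k) i) :
  forall i j, enorm (x k i - x k j) @[k --> \oo] --> (0 : R).
Proof.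
have f_diff i z : differentiable (f i) z by case: (f_C2 i).
have gradf_diff i z : differentiable (grad (f i)) z by case: (f_C2 i).
have gradg_diff e : e \in E -> forall z, differentiable (grad (g e)) z.
  by move=> /g_C2[].
have b0 i : 0 <= bregman (f i) xstar (xmin i).
  exact: bregman_at_minimizer_ge0.
have V0_ge0 : 0 <= V0 by apply: sumr_ge0.
(* The end point [i] alone is kept: [i] and [j] range over ordered pairs, so the other end is
   covered by exchanging them. *)
have alpha_lt' i j : link i j \in E -> alpha (link i j) <
    1 / (2 * Gamma (link i j)) * step_bound E V0 theta Theta' theta' L' i.
  move=> ij; apply: lt_le_trans (alpha_lt i j ij) _.
  rewrite ler_wpM2l ?ge_min ?lexx //.
  by rewrite divr_ge0 // mulr_ge0 // ltW // Gamma_gt0.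
pose V k := lyapunov f xstar (x k).
pose margin := link_margin E V0 theta Theta' theta' L' Gamma alpha.
have stepE k : x k.+1 = dean_step E f g alpha (x k) by apply/funext.
have margin_gt0 i j : link i j \in E -> 0 < margin i j by exact: link_margin_gt0.
have bregC k : (forall i, 0 <= bregman (f i) xstar (x k i)) -> V k <= V0 ->
    forall i, C i (x k i).
  move=> bk Vk i; apply: le_trans Vk; rewrite /V /lyapunov (bigD1 i) //=.
  by rewrite lerDl sumr_ge0.
have energy_ge k : (forall i, C i (x k i)) -> forall i j, link i j \in E ->
    gamma (link i j) * enorm (x k i - x k j) ^+ 2 <= link_energy g (x k) i j.
  by move=> Ck i j ij; exact: (link_energy_ge gradg_diff g_bnd Ck ij).
have energy_ge0 k : (forall i, C i (x k i)) -> forall i j, link i j \in E ->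
    0 <= margin i j * link_energy g (x k) i j.
  move=> Ck i j ij; rewrite mulr_ge0 ?(ltW (margin_gt0 _ _ _)) //.
  by rewrite (le_trans _ (energy_ge k Ck i j ij)) // mulr_ge0 ?sqr_ge0 ?ltW ?gamma_gt0.
have descent k : (forall i, C i (x k i)) ->
    V k.+1 + \sum_i \sum_(j in neighbors E i) margin i j * link_energy g (x k) i j
      <= V k.
  move=> Ck; rewrite /V stepE.
  exact: (lyapunov_dean_step_le f_diff gradf_diff gradg_diff V0_ge0 theta_gt0
    L'_ge0 Gamma_gt0 gamma_gt0 f_bnd g_bnd f_bnd' f_L' alpha_gt0
    alpha_le alpha_lt' Ck).
(* Both facts are carried together: they place the iterates in the sets [C i], which is what the
   descent estimate and the nonnegativity at the next step require. *)
have inv k : (forall i, 0 <= bregman (f i) xstar (x k i)) /\ V k <= V0.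
  elim: k => [|k [bk Vk]].
    by rewrite /V (_ : x 0%N = xmin) //; apply/funext.
  have Ck := bregC k bk Vk; split.
    move=> i; rewrite stepE.
    exact: (bregman_dean_step_ge0 f_diff gradf_diff gradg_diff V0_ge0 theta_gt0
      theta'_gt0 Gamma_gt0 gamma_gt0 f_bnd g_bnd f_bnd' alpha_gt0 alpha_le Ck).
  apply: le_trans Vk; apply: le_trans (descent k Ck); rewrite lerDl.
  apply: sumr_ge0 => i _; apply: sumr_ge0 => j; rewrite inE; exact: energy_ge0.
have Ck k : forall i, C i (x k i) by have [bk Vk] := inv k; exact: bregC.
have V_ge0 k : 0 <= V k by apply: sumr_ge0 => i _; case: (inv k).
have link_decay k i j : link i j \in E ->
    margin i j * gamma (link i j) * enorm (x k i - x k j) ^+ 2 <= V k - V k.+1.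
  move=> ij; apply: (@le_trans _ _ (margin i j * link_energy g (x k) i j)).
    by rewrite -mulrA ler_pM2l ?margin_gt0 // energy_ge.
  rewrite lerBrDl; apply: le_trans (descent k (Ck k)); rewrite lerD2l.
  (* The term of the ordered pair [i], [j] is singled out; all the others are nonnegative. *)
  rewrite (bigD1 i) //= (bigD1 j) ?inE //= -addrA lerDl addr_ge0 //.
    by apply: sumr_ge0 => l /andP[]; rewrite inE => il _; exact: energy_ge0.
  apply: sumr_ge0 => l _; apply: sumr_ge0 => m; rewrite inE; exact: energy_ge0.
have V_dec k : V k.+1 <= V k.
  apply: le_trans (descent k (Ck k)); rewrite lerDl.
  apply: sumr_ge0 => i _; apply: sumr_ge0 => j; rewrite inE; exact: energy_ge0.
apply: (consensus_of_links hconn) => i j ij.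
pose c := margin i j * gamma (link i j).
have c0 : 0 < c by rewrite mulr_gt0 ?margin_gt0 ?gamma_gt0.
(* The upper bound is [link_decay] divided by [c], under a square root; the decrements of [V] tend
   to zero. *)
apply: (@squeeze_cvgr _ _ _ _ (cst 0)
  (fun k => Num.sqrt (c^-1 * (V k - V k.+1)))).
- near=> k; rewrite enorm_ge0 /= /enorm -enorm_sqr ler_wsqrtr //.
  by rewrite ler_pdivlMl // link_decay.
- exact: cvg_cst.
- have dV0 : c^-1 * (V k - V k.+1) @[k --> \oo] --> (0 : R).
    by rewrite -(mulr0 c^-1); apply: cvgM; [exact: cvg_cst|exact: cvg_sub_succ0].
  have := continuous_cvg _ (@sqrt_continuous R 0) dV0; rewrite sqrtr0; exact.
Unshelve. all: by end_near. Qed.
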